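(* Let $D\subseteq \mathbb{R}^n$ be an open and convex set, let $T:D\to \mathbb{R}^n$ be an operator of class $C^1$ and let $A:\mathbb{R}^n\to \mathbb{R}^n$ be a linear operator with $\det A\neq 0$. Assume that for every $x\in D$ one of the following conditions holds. (a) $\det\left(A^\top J_T(x)+ J^\top_T(x)A\right)_{1\le i,j\le m}>0$ for all $m\in\{1,2,\ldots,n\}$. (b) $(-1)^m\det\left(A^\top J_T(x)+ J^\top_T(x)A\right)_{1\le i,j\le m}>0$ for all $m\in\{1,2,\ldots,n\}$. Then $T$ is injective.
   Context: $\mathbb{R}^n$ is endowed with the usual Euclidean scalar product. The linear operator $A$ is identified with its real $n\times n$ matrix $(a_{ij})_{1\le i,j\le n}$, and $A^\top$ denotes the transpose of $A$. For $T=(t_1,\ldots,t_n)$ and $x\in D$, $J_T(x)=\left(\frac{\partial t_i}{\partial x_j}(x)\right)_{1\le i,j\le n}$ is the Jacobian matrix of $T$ at $x$ and $J_T^\top(x)$ is its transpose. For a square matrix $B$ of order $n$, $(B)_{1\le i,j\le m}$ denotes the submatrix obtained by deleting the last $n-m$ rows and the last $n-m$ columns of $B$ (so its determinant is the $m$-th leading principal minor). *)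

(* Defs.v *)
From HB Require Import structures.
From mathcomp Require Import all_boot all_order all_algebra.
From mathcomp Require Import all_classical all_reals all_analysis.

Set Implicit Arguments.
Unset Strict Implicit.
Unset Printing Implicit Defensive.

Import Order.TTheory GRing.Theory Num.Theory.
Import numFieldNormedType.Exports.

Local Open Scope classical_set_scope.
Local Open Scope ring_scope.

(* Vectors of R^n are column vectors, so that a matrix A acts as x |-> A *m x.
   A map on an open set D is represented by a total function; partial
   derivatives at a point of D only depend on its restriction to D. *)

Definition component (R : realType) (n : nat) (T : 'cV[R]_n -> 'cV[R]_n)
  (i : 'I_n) : 'cV[R]_n -> R := fun x => T x i 0.

Definition basis_vec (R : realType) (n : nat) (j : 'I_n) : 'cV[R]_n :=
  delta_mx j 0.

Definition class_C1 (R : realType) (n : nat) (D : set 'cV[R]_n)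
  (T : 'cV[R]_n -> 'cV[R]_n) : Prop :=
  forall i j : 'I_n,
    (forall x, D x -> derivable (component T i) x (basis_vec R j)) /\
    {within D, continuous (fun x => 'D_(basis_vec R j) (component T i) x)}.

(* Row index for the component, column index for the variable. The library's
   ['J f x], which acts on row vectors, is the transpose of this. *)
Definition jacobian_mx (R : realType) (n : nat) (T : 'cV[R]_n -> 'cV[R]_n)
  (x : 'cV[R]_n) : 'M[R]_n :=
  \matrix_(i, j) 'D_(basis_vec R j) (component T i) x.

Definition leading_submx (R : Type) (n m : nat) (le_mn : (m <= n)%N)
  (B : 'M[R]_n) : 'M[R]_m :=
  mxsub (widen_ord le_mn) (widen_ord le_mn) B.

(* Main.v *)
Require Import Defs.
From mathcomp Require Import all_boot all_order all_algebra.
From mathcomp Require Import all_classical all_reals all_analysis.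
Import Order.TTheory GRing.Theory Num.Theory.
Import numFieldNormedType.Exports.

Local Open Scope classical_set_scope.
Local Open Scope ring_scope.

(* If T x = T y with v = y - x <> 0, then g(t) = <A v, T (x + t v)> takes the
   same value at 0 and 1, so by Rolle g'(t) = <A v, J_T(x + t v) v> vanishes for
   some t. But 2 g'(t) = v^T (A^T J_T + J_T^T A) v, and by Sylvester's criterion
   this quadratic form is positive or negative definite. Only the single point
   x + t v matters, so (a) and (b) may a priori alternate over D. *)

(** Subtracting [l] times the upper block row from the lower one clears the corner [l *m P]. Giving
    the corner this shape keeps the inverse of [P] out of the formula. *)
Lemma det_block_schur (F : comPzRingType) (m n : nat) (P : 'M[F]_m)
    (b : 'M[F]_(m, n)) (l : 'M[F]_(n, m)) (c : 'M[F]_n) :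
  \det (block_mx P b (l *m P) c) = \det P * \det (c - l *m b).
Proof.
have -> : block_mx P b (l *m P) c =
    block_mx 1%:M 0 l 1%:M *m block_mx P b 0 (c - l *m b).
  by rewrite mulmx_block !mul1mx !mul0mx !addr0 addrC subrK.
by rewrite det_mulmx det_lblock det_ublock !det1 !mul1r.
Qed.

(** Completing the square: the shift [u + k *m s] absorbs both cross terms, and the surplus
    [k^T *m (P *m k)] is taken off [c]. *)
Lemma quadratic_form_block (F : comPzRingType) (m n p : nat) (P : 'M[F]_m)
    (c : 'M[F]_n) (k : 'M[F]_(m, n)) (u : 'M[F]_(m, p)) (s : 'M[F]_(n, p)) :
  (col_mx u s)^T *m block_mx P (P *m k) (k^T *m P) c *m col_mx u s =
  (u + k *m s)^T *m P *m (u + k *m s) +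
    s^T *m (c - k^T *m (P *m k)) *m s.
Proof.
rewrite tr_col_mx mul_row_block mul_row_col !linearD /= trmx_mul.
rewrite !mulmxDl !linearN /= !mulNmx !mulmxA.
by rewrite -!addrA; do 3!congr (_ + _); rewrite addrC subrK.
Qed.

Lemma leading_submx_id (T : Type) (n : nat) (le_nn : (n <= n)%N) (B : 'M[T]_n) :
  leading_submx le_nn B = B.
Proof. by apply/matrixP => i j; rewrite mxE; congr (B _ _); exact: val_inj. Qed.

(* Completing the square with k = P^-1 b, where P is the leading block of size n
   and b the rest of the last column: det B is det P times the Schur complement. *)
Lemma sylvester_criterion (F : realFieldType) (n : nat) (B : 'M[F]_n) :
  B^T = B ->
  (forall (m : nat) (le_mn : (m <= n)%N), (1 <= m)%N ->
    0 < \det (leading_submx le_mn B)) ->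
  forall v : 'cV[F]_n, v != 0 -> 0 < (v^T *m B *m v) 0 0.
Proof.
elim: n B => [|n IHn].
  by move=> B _ _ v; rewrite [v]flatmx0 eqxx.
rewrite -addn1 => B Bsym minors v v_neq0.
pose P := ulsubmx B; pose b := ursubmx B; pose c := drsubmx B.
have Psym : P^T = P by rewrite /P trmx_ulsub Bsym.
have Bdl : dlsubmx B = b^T by rewrite /b trmx_ursub Bsym.
have Pminors m (le_mn : (m <= n)%N) :
    (1 <= m)%N -> 0 < \det (leading_submx le_mn P).
  move=> m_gt0; have le_mn1 : (m <= n + 1)%N by rewrite (leq_trans le_mn) ?leq_addr.
  have -> : leading_submx le_mn P = leading_submx le_mn1 B.
    by apply/matrixP => i j; rewrite !mxE; congr (B _ _); apply: val_inj.
  exact: minors.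
have detP : 0 < \det P.
  (* The minors start at order 1, so an empty [P], of determinant 1, is treated apart. *)
  have [n0|n_gt0] := posnP n.
    by move: (P); rewrite n0 => P0; rewrite det_mx00.
  by rewrite -(leading_submx_id _ _ (leqnn n) P) Pminors.
have detB : 0 < \det B.
  by rewrite -(leading_submx_id _ _ (leqnn _) B) minors ?leq_addl.
have Punit : P \in unitmx by rewrite unitmxE unitfE gt_eqF.
pose k := invmx P *m b.
have Pk : P *m k = b by rewrite /k mulmxA mulmxV// mul1mx.
have kP : k^T *m P = b^T by rewrite -Pk (trmx_mul P k) Psym.
have BE : B = block_mx P (P *m k) (k^T *m P) c by rewrite Pk kP -Bdl submxK.
pose e := (c - k^T *m (P *m k)) 0 0.
have schurE : c - k^T *m (P *m k) = e%:M by exact: mx11_scalar.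
have e_gt0 : 0 < e.
  by move: detB; rewrite BE det_block_schur det_mx11 pmulr_rgt0.
rewrite -[v]vsubmxK in v_neq0 *; move: (usubmx v) (dsubmx v) v_neq0 => u s us_neq0.
rewrite BE quadratic_form_block mxE; set w := u + _.
have -> : (s^T *m (c - k^T *m (P *m k)) *m s) 0 0 = e * (s 0 0) ^+ 2.
  by rewrite schurE mul_mx_scalar -scalemxAl !mxE big_ord1 !mxE expr2.
(* If [w] vanishes, only [e * s^2] is left, and [s] is nonzero because [s = 0] would force
   [u = 0]. *)
have [w0|w_neq0] := eqVneq w 0.
  rewrite w0 mulmx0 mxE add0r pmulr_rgt0// exprn_even_gt0//=.
  apply: contra_neq us_neq0 => s00.
  have s0 : s = 0 by apply/matrixP => i j; rewrite !ord1 s00 mxE.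
  by move: w0; rewrite /w s0 mulmx0 addr0 => ->; rewrite col_mx0.
by rewrite ltr_pwDl ?IHn// mulr_ge0 ?sqr_ge0// ltW.
Qed.

Lemma is_derive_line (R : realType) (V W : normedModType R) (f : V -> W) (q v : V)
    (t : R) (d : W) :
  is_derive (t *: v + q) v f d -> is_derive t 1 (fun s : R => f (s *: v + q)) d.
Proof.
move=> [fd fE].
have E : (fun h : R => h^-1 *: (f ((h *: 1 + t) *: v + q) - f (t *: v + q))) =
         (fun h : R => h^-1 *: (f (h *: v + (t *: v + q)) - f (t *: v + q))).
  by apply/funext => h; rewrite [h *: 1]mulr1 scalerDl addrA.
split; first by move: fd; rewrite /derivable /= -E.
by move: fE; rewrite /derive /= -E.
Qed.

(** The mean value theorem on [[0, 1]] for [t |-> f ((t * a) *: v + q)]; rescaling to the unit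
    interval treats every sign of [a] at once. *)
Lemma mean_value_line (R : realType) (V : normedModType R) (f : V -> R)
    (q v : V) (a : R) :
  (forall t : R, 0 <= t <= 1 -> derivable f ((t * a) *: v + q) v) ->
  exists2 t : R, 0 <= t <= 1 &
    f (a *: v + q) - f q = a * 'D_v f ((t * a) *: v + q).
Proof.
move=> fd.
pose g (t : R) := f ((t * a) *: v + q).
have gd (t : R) : 0 <= t <= 1 ->
    is_derive t 1 g ('D_v f ((t * a) *: v + q) * a).
  move=> t01; apply: (is_derive1_comp (f := fun s => f (s *: v + q)) (g := fun t => t * a)).
    by apply: is_derive_line; apply: derivableP; exact: fd.
  (* Multiplication by [a] is the identity along the line of direction [a], so its derivative is
     [a]. *)
  rewrite (_ : (fun t => t * a) = (fun t : R => id (t *: a + 0))).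
    exact: is_derive_line (is_derive_id _ _).
  by apply/funext => s; rewrite addr0.
have [|t||t t01] := @MVT_segment R g (fun t => 'D_v f ((t * a) *: v + q) * a) 0 1.
- exact: ler01.
- by rewrite in_itv /= => /andP[t0 t1]; apply: gd; rewrite !ltW.
- apply: derivable_within_continuous => t; rewrite in_itv /= => t01.
  by have [] := gd t t01.
rewrite /g mul1r mul0r scale0r add0r subr0 mulr1 => ->; rewrite in_itv/= in t01.
by exists t => //; rewrite mulrC.
Qed.

(* Moving first along w and then along e, the second increment is given by the
   mean value theorem at a point tending to p. *)
Lemma is_deriveDdir (R : realType) (V : normedModType R) (f : V -> R)
    (p w e : V) (c d : R) :
  is_derive p w f d -> (\forall x \near p, derivable f x e) ->
  {for p, continuous (fun x => 'D_e f x)} ->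
  is_derive p (c *: e + w) f (c * 'D_e f p + d).
Proof.
move=> [fw fwE] fe De.
suff H : (fun h => h^-1 *: ((f \o shift p) (h *: (c *: e + w)) - f p)) @ 0^' -->
    c * 'D_e f p + d.
  by split; [apply/cvg_ex; eexists; exact: H|exact: cvg_lim H].
have -> : (fun h => h^-1 *: ((f \o shift p) (h *: (c *: e + w)) - f p)) =
   (fun h => h^-1 * (f ((h * c) *: e + (h *: w + p)) - f (h *: w + p))) \+
   (fun h => h^-1 *: ((f \o shift p) (h *: w) - f p)).
  apply/funext => h /=; rewrite -[h^-1 * _]/(h^-1 *: _ : R) -scalerDr.
  by rewrite addrA subrK [h *: (_ + _)]scalerDr scalerA addrA.
apply: cvgD; last by rewrite -fwE.
apply/cvgrPdist_le => eps eps_gt0.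
(* The error will be [|c|] times this bound; the added 1 allows [c = 0]. *)
have eps'_gt0 : 0 < eps / (`|c| + 1) by rewrite divr_gt0// ltr_wpDl.
have := De => /cvgrPdist_le /(_ _ eps'_gt0) De'.
have : \forall x \near p, derivable f x e /\
    `|'D_e f p - 'D_e f x| <= eps / (`|c| + 1) by near do split.
move=> /nbhs_ballP[r /= r_gt0]; rewrite -ball_normE /= => rP.
(* All points used lie within [|h| * (|c| * |e| + |w|)] of [p]; the added 1 makes the divisor
   positive. *)
have M_gt0 : 0 < `|c| * `|e| + `|w| + 1 by rewrite ltr_wpDl// addr_ge0// mulr_ge0.
near=> h.
have h_neq0 : h != 0 by near: h; exact: nbhs_dnbhs_neq.
have hr : `|h| < r / (`|c| * `|e| + `|w| + 1).
  by near: h; apply: dnbhs0_lt; rewrite divr_gt0.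
have near_p t : 0 <= t <= 1 ->
    `|p - ((t * (h * c)) *: e + (h *: w + p))| < r.
  move=> /andP[t0 t1].
  rewrite addrA opprD addrCA subrr addr0 normrN.
  rewrite (le_lt_trans (ler_normD _ _))// !normrZ (ger0_norm t0).
  move: hr; rewrite ltr_pdivlMr//; apply: le_lt_trans.
  rewrite 2!mulrDr mulr1 -addrA lerD ?lerDl// [leRHS]mulrA.
  by rewrite ler_wpM2r// ler_piMl// mulr_ge0.
have [|t t01 ->] := @mean_value_line R V f (h *: w + p) e (h * c).
  by move=> t /near_p /rP[].
have [_ le_eps] := rP _ (near_p _ t01).
rewrite -[h * c * 'D_e f _]mulrA mulKf// -mulrBr normrM.
rewrite (le_trans (ler_wpM2l _ le_eps))// mulrCA ger_pMr// ler_pdivrMr ?ltr_wpDl//.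
by rewrite mul1r lerDl.
Unshelve. all: by end_near. Qed.

(** The direction [v] is assembled one coordinate at a time, starting from the zero direction. *)
Lemma is_derive_partial (R : realType) (n : nat) (f : 'cV[R]_n -> R)
    (p v : 'cV[R]_n) :
  (forall j, \forall x \near p, derivable f x (basis_vec R j)) ->
  (forall j, {for p, continuous (fun x => 'D_(basis_vec R j) f x)}) ->
  is_derive p v f (\sum_j v j 0 * 'D_(basis_vec R j) f p).
Proof.
move=> fd fc.
have vE : v = \sum_j v j 0 *: basis_vec R j.
  by rewrite [LHS]matrix_sum_delta; apply: eq_bigr => j _; rewrite big_ord1.
rewrite [X in is_derive _ X]vE.
elim: (index_enum _) => [|j s IHs].
  by rewrite !big_nil; exact: is_derive0.
by rewrite !big_cons; exact: is_deriveDdir.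
Qed.

Lemma convex_set_line (R : realType) (V : normedModType R) (D : set V) (x y : V)
    (t : R) :
  convex_set D -> D x -> D y -> 0 <= t <= 1 -> D (t *: (y - x) + x).
Proof.
move=> cD Dx Dy t01.
have := cD y x (Itv01 (andP t01).1 (andP t01).2); rewrite !inE => /(_ Dy Dx).
by congr D; rewrite /conv /= scalerBr scalerBl scale1r addrA addrAC.
Qed.

(** The two summands are 1 by 1 matrices and transposes of each other, hence equal. *)
Lemma double_quadratic_form (F : comPzRingType) (n : nat) (A J : 'M[F]_n) (v : 'cV[F]_n) :
  v^T *m (A^T *m J + J^T *m A) *m v = ((A *m v)^T *m (J *m v)) *+ 2.
Proof.
have tr11 (M : 'M[F]_1) : M^T = M by apply/matrixP => i j; rewrite mxE !ord1.
rewrite mulmxDr mulmxDl -[v^T *m (J^T *m A) *m v]tr11 mulr2n.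
by rewrite !trmx_mul !trmxK !mulmxA.
Qed.

Theorem theorem2p2 (R : realType) (n : nat) (D : set 'cV[R]_n)
    (T : 'cV[R]_n -> 'cV[R]_n) (A : 'M[R]_n)
    (D_open : open D) (D_convex : convex_set D) (T_C1 : class_C1 D T)
    (detA_neq0 : \det A != 0)
    (minors : forall x, D x ->
      (forall (m : nat) (le_mn : (m <= n)%N), (1 <= m)%N ->
        0 < \det (leading_submx le_mn
                    (A^T *m jacobian_mx T x + (jacobian_mx T x)^T *m A)))
      \/
      (forall (m : nat) (le_mn : (m <= n)%N), (1 <= m)%N ->
        0 < (-1) ^+ m * \det (leading_submx le_mn
                    (A^T *m jacobian_mx T x + (jacobian_mx T x)^T *m A)))) :
  {in D &, injective T}.
Proof.
move=> x y /set_mem Dx /set_mem Dy Txy; apply/esym/eqP; rewrite -subr_eq0.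
apply/negP => /negP v_neq0; set v := y - x in v_neq0.
pose a := A *m v.
pose f (z : 'cV[R]_n) := \sum_i a i 0 * T z i 0.
have fd (z : 'cV[R]_n) : D z ->
    is_derive z v f ((a^T *m (jacobian_mx T z *m v)) 0 0).
  move=> Dz.
  have -> : f = \sum_i a i 0 *: (component T i).
    by apply/funext => w; rewrite fct_sumE.
  have -> : (a^T *m (jacobian_mx T z *m v)) 0 0 =
      \sum_i a i 0 *: \sum_j v j 0 * 'D_(basis_vec R j) (component T i) z.
    rewrite mxE; apply: eq_bigr => i _; rewrite !mxE; congr (_ * _).
    by apply: eq_bigr => j _; rewrite mxE mulrC.
  apply: is_derive_sum => i; apply: is_deriveZ; apply: is_derive_partial => j.
    have := open_nbhs_nbhs (conj D_open Dz); apply: filterS => w.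
    by have [+ _] := T_C1 i j; exact.
  (* As [D] is open, continuity within [D] is continuity at each of its points. *)
  have [_] := T_C1 i j; rewrite continuous_open_subspace// => /(_ z); apply.
  exact: mem_set.
pose g (t : R) := f (t *: v + x).
have gd (t : R) : t \in `[0, 1] ->
    is_derive t 1 g ((a^T *m (jacobian_mx T (t *: v + x) *m v)) 0 0).
  rewrite in_itv /= => t01.
  by apply: is_derive_line; apply: fd; exact: convex_set_line.
have [||||t t01 [_ g0]] := @Rolle R g 0 1.
- exact: ltr01.
- by move=> t /subset_itv_oo_cc t01; have [] := gd t t01.
- by apply: derivable_within_continuous => t t01; have [] := gd t t01.
- by rewrite /g /f scale0r scale1r add0r subrK Txy.
have t01' := subset_itv_oo_cc t01.
have := gd t t01' => -[_]; rewrite g0 => /esym form0.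
have /minors : D (t *: v + x) by apply: convex_set_line.
set J := jacobian_mx T _ in form0 *; set S := A^T *m J + J^T *m A.
have Ssym : S^T = S.
  by rewrite /S linearD /= !trmx_mul !trmxK addrC.
have S0 : (v^T *m S *m v) 0 0 = 0.
  by rewrite double_quadratic_form mulr2n mxE -/a form0 addr0.
case=> [pos|neg].
  by have := sylvester_criterion _ _ S Ssym pos v v_neq0; rewrite S0 ltxx.
(* In case (b) the criterion applies to [- S], whose minor of order [m] is [(-1) ^+ m] times that of
   [S]. *)
have NSsym : (- S)^T = - S by rewrite linearN /= Ssym.
have := sylvester_criterion _ _ (- S) NSsym _ v v_neq0.
rewrite mulmxN mulNmx mxE S0 oppr0 ltxx => false_if_minors; suff : false by [].
apply: false_if_minors => m le_mn m_gt0.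
have -> : leading_submx le_mn (- S) = (-1) *: leading_submx le_mn S.
  by apply/matrixP => i j; rewrite !mxE mulN1r.
by rewrite detZ neg.
Qed.
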